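(* For every $\mu\in\mathcal E^+$ one has $\gamma^*(G\mu)=\gamma_*(G\mu)=\|\mu\|$.
   Context: $X$ is a nonempty locally compact Hausdorff space, $\mathcal M^+$ the set of positive Radon measures on $X$. $G:X\times X\to[0,+\infty]$ is a kernel: lower semicontinuous (l.s.c.), symmetric, and $G(x,x)>0$ for all $x$. For $\mu\in\mathcal M^+$: $G\mu(x)=\int G(x,y)\,d\mu(y)$, $\|\mu\|=(\int G\mu\,d\mu)^{1/2}$; $\mathcal E^+=\{\mu\in\mathcal M^+:\|\mu\|<+\infty\}$, $\mathcal E^+_1=\{\mu\in\mathcal M^+:\|\mu\|\le1\}$. $\mathcal F^+$: all functions $X\to[0,+\infty]$. $\mathcal G$: l.s.c. functions in $\mathcal F^+$. $\mathcal C_0^+$: finite continuous functions $X\to[0,+\infty[$ of compact support. Energy capacity: $c(\varphi)=\max\{\int\varphi\,d\mu:\mu\in\mathcal E_1^+\}$ for $\varphi\in\mathcal C_0^+$; $c(g)=\sup\{c(\varphi):\varphi\in\mathcal C_0^+,\varphi\le g\}$ for $g\in\mathcal G$; $c^*(f)=\inf\{c(g):g\in\mathcal G,g\ge f\}$ for $f\in\mathcal F^+$; $c^*(E)=c^*(1_E)$ for $E\subset X$. q.e. means: except on a set $E$ with $c^*(E)=0$. For $f\in\mathcal F^+$ let $\Gamma^*(f)=\{\lambda\in\mathcal E^+: G\lambda\ge f\text{ q.e.}\}$ and $\Gamma_*(f)=\{\lambda\in\mathcal E^+:\int G\lambda\,d\nu\ge\int_*f\,d\nu\text{ for all }\nu\in\mathcal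 E^+\}$, where $\int_*$ is the lower integral. The upper and lower dual capacities are $\gamma^*(f)=\inf\{\|\lambda\|:\lambda\in\Gamma^*(f)\}$ and $\gamma_*(f)=\inf\{\|\lambda\|:\lambda\in\Gamma_*(f)\}$, with infimum of the empty set equal to $+\infty$. *)

(* Defs.v *)
From HB Require Import structures.
From mathcomp Require Import all_boot all_order all_algebra.
From mathcomp Require Import all_classical all_reals all_analysis.
From mathcomp Require Import measurable_realfun.

Set Implicit Arguments.
Unset Strict Implicit.
Unset Printing Implicit Defensive.

Import Order.TTheory GRing.Theory Num.Theory.
Import numFieldNormedType.Exports.

Local Open Scope classical_set_scope.
Local Open Scope ring_scope.
Local Open Scope ereal_scope.

(** A nonempty topological space is a [ptopologicalType]; [borel X] is [X] with
    its Borel sigma-algebra. *)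
Notation borel X := (g_sigma_algebraType (@open X)).

Section EnergyCapacity.
Context {R : realType} {X : ptopologicalType}.

Local Notation measure_on_X := {measure set (borel X) -> \bar R}.

(** Positive Radon measures, as Borel measures that are finite on compact sets
    and inner regular on every Borel set. On a locally compact Hausdorff space
    these correspond bijectively to the positive linear forms on the continuous
    functions of compact support. *)
Definition radon (mu : measure_on_X) : Prop :=
  (forall K : set X, compact K -> mu K < +oo) /\
  (forall A : set (borel X), measurable A ->
    mu A = ereal_sup [set mu K | K in [set K : set X | compact K /\ K `<=` A]]).

Record is_kernel (G : X * X -> \bar R) : Prop := IsKernel {
  kernel_ge0 : forall z, 0 <= G z ;
  kernel_lsc : lower_semicontinuous G ;
  kernel_sym : forall x y, G (x, y) = G (y, x) ;
  kernel_diag_gt0 : forall x, 0 < G (x, x) }.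

Definition potential (G : X * X -> \bar R) (mu : measure_on_X) : X -> \bar R :=
  fun x => \int[mu]_y G (x, y).

Definition energy_norm (G : X * X -> \bar R) (mu : measure_on_X) : \bar R :=
  sqrte (\int[mu]_x potential G mu x).

Definition Eplus (G : X * X -> \bar R) : set measure_on_X :=
  [set mu | radon mu /\ energy_norm G mu < +oo].

Definition Eplus1 (G : X * X -> \bar R) : set measure_on_X :=
  [set mu | radon mu /\ energy_norm G mu <= 1].

Definition Fplus : set (X -> \bar R) := [set f | forall x, 0 <= f x].

Definition lscplus : set (X -> \bar R) :=
  [set g | Fplus g /\ lower_semicontinuous g].

Definition Ccplus : set (X -> R) :=
  [set phi : X -> R | [/\ continuous phi, (forall x, 0 <= phi x)%R &
                 compact (closure [set x | phi x != 0%R])]].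

Definition cap_cont (G : X * X -> \bar R) (phi : X -> R) : \bar R :=
  ereal_sup [set \int[mu]_x (phi x)%:E | mu in Eplus1 G].

Definition cap_lsc (G : X * X -> \bar R) (g : X -> \bar R) : \bar R :=
  ereal_sup [set cap_cont G phi | phi in
    [set phi : X -> R | Ccplus phi /\ forall x, (phi x)%:E <= g x]].

Definition outer_cap (G : X * X -> \bar R) (f : X -> \bar R) : \bar R :=
  ereal_inf [set cap_lsc G g | g in
    [set g | lscplus g /\ forall x, f x <= g x]].

Definition outer_cap_set (G : X * X -> \bar R) (E : set X) : \bar R :=
  outer_cap G (fun x => (\1_E x)%:E).

Definition quasi_everywhere (G : X * X -> \bar R) (P : X -> Prop) : Prop :=
  exists E : set X, outer_cap_set G E = 0 /\ forall x, ~ E x -> P x.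

(** By inner regularity the supremum is the same when restricted to the finite
    upper semicontinuous functions [h <= f] of compact support. *)
Definition lower_integral (nu : measure_on_X) (f : X -> \bar R) : \bar R :=
  ereal_sup [set \int[nu]_x h x | h in
    [set h : borel X -> \bar R |
      [/\ measurable_fun [set: borel X] h, (forall x, 0 <= h x) &
          (forall x, h x <= f x)]]].

Definition Gamma_upper (G : X * X -> \bar R) (f : X -> \bar R) :
    set measure_on_X :=
  [set la | Eplus G la /\
    quasi_everywhere G (fun x => f x <= potential G la x)].

Definition Gamma_lower (G : X * X -> \bar R) (f : X -> \bar R) :
    set measure_on_X :=
  [set la | Eplus G la /\
    forall nu, Eplus G nu ->
      lower_integral nu f <= \int[nu]_x potential G la x].

Definition dual_cap_upper (G : X * X -> \bar R) (f : X -> \bar R) : \bar R :=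
  ereal_inf [set energy_norm G la | la in Gamma_upper G f].

Definition dual_cap_lower (G : X * X -> \bar R) (f : X -> \bar R) : \bar R :=
  ereal_inf [set energy_norm G la | la in Gamma_lower G f].

End EnergyCapacity.

(* Main.v *)
Require Import Defs.
From HB Require Import structures.
From mathcomp Require Import all_boot all_order all_algebra.
From mathcomp Require Import all_classical all_reals all_analysis.
From mathcomp Require Import measurable_realfun lra.

Set Implicit Arguments.
Unset Strict Implicit.
Unset Printing Implicit Defensive.

Import Order.TTheory GRing.Theory Num.Theory.
Import numFieldNormedType.Exports.

Local Open Scope classical_set_scope.
Local Open Scope ring_scope.
Local Open Scope ereal_scope.

(** The inequality [dual_cap_upper <= energy_norm] is free: [mu] itself
    competes. For the converse, let [la] belong to [Gamma_lower]. Testing [la]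
    against [mu] and against [la] and writing [<mu, la>] for the mutual energy,
      [|mu|^2 <= <la, mu> = <mu, la> <= |la|^2],
    so no competitor has a smaller norm than [mu] ([energy_norm_min]).
    The two dual capacities are compared by [Gamma_upper_sub_lower]: a measure
    of finite energy does not charge the sets of outer capacity zero, hence an
    inequality that holds quasi-everywhere may be integrated.

    Two facts carry the weight.

    - Symmetry of the mutual energy is a Tonelli theorem for a lower
      semicontinuous kernel and two Radon measures ([tonelli_radon]). Neither
      sigma-finiteness nor measurability of the kernel for the product
      sigma-algebra is available, as [X] need not be second countable. Instead,
      inner regularity says that an integral is the supremum of the integrals
      of step functions carried by finitely many compact sets and lying strictly
      below the integrand ([integral_le_step_sup]). Strictness, compactness and
      lower semicontinuity make such a step function for the section at [x0]
      remain below the sections at all nearby [x]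
      ([step_below_section_nbhs]). This gives the lower semicontinuity of
      potentials, and, by covering compact sets with such neighbourhoods, it
      bounds one iterated integral by the other.

    - That measures of finite energy ignore capacity zero follows from Urysohn
      functions: if [g] is a lower semicontinuous majorant of the indicator of
      a set, then on each compact subset [K] half the indicator of [K] lies
      below a test function that lies below [g], and the capacity of a test
      function bounds its integral against every normalized measure
      ([cap_lsc_ge_compact], [zero_capacity_null]). *)

(** * Lower semicontinuous functions and compact sets *)

Section Semicontinuity.
Context {R : realType}.

Lemma open_borel {X : ptopologicalType} (U : set X) :
  open U -> measurable (U : set (borel X)).
Proof. by move=> oU; exact: sub_sigma_algebra. Qed.

Lemma compact_borel {X : ptopologicalType} (K : set X) :
  hausdorff_space X -> compact K -> measurable (K : set (borel X)).
Proof.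
move=> hX cK; rewrite -[K]setCK; apply: measurableC; apply: open_borel.
by rewrite openC; exact: compact_closed.
Qed.

Lemma lsc_borel {X : ptopologicalType} (f : X -> \bar R) :
  lower_semicontinuous f -> measurable_fun [set: borel X] f.
Proof.
move=> scf; apply: (measurability _ (ErealGenOInfty.measurableE R)).
move=> /= _ [_ [a ->]] <-; apply: measurableI => //; apply: open_borel.
by rewrite preimage_itvoy; move/lower_semicontinuousP : scf; exact.
Qed.

Lemma lsc_swap {X Y : topologicalType} (H : X * Y -> \bar R) :
  lower_semicontinuous H ->
  lower_semicontinuous (fun z : Y * X => H (z.2, z.1)).
Proof.
move=> lH [y x] a /= /lH [V [[A B] /= [nA nB] AB] HV].
exists (B `*` A) => /=; first by exists (B, A).
by move=> [y' x'] /= [By' Ax']; apply: HV; exact: (AB (x', y')).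
Qed.

Lemma lsc_section {X Y : topologicalType} (H : X * Y -> \bar R) (x : X) :
  lower_semicontinuous H -> lower_semicontinuous (fun y => H (x, y)).
Proof.
move=> lH y a /lH [V [[A B] /= [nA nB] AB] HV].
exists B => // y' By'; apply: HV; apply: (AB (x, y')); split => //=.
exact: nbhs_singleton.
Qed.

(** The tube lemma: a strict lower bound on a compact set of one section is
    inherited by the neighbouring sections. *)
Lemma lsc_tube {X Y : topologicalType} (H : X * Y -> \bar R) (K : set Y)
    (x0 : X) (b : R) : lower_semicontinuous H -> compact K ->
  (forall y, K y -> b%:E < H (x0, y)) ->
  \forall x \near x0, forall y, K y -> b%:E < H (x, y).
Proof.
move=> lH /compact_near_coveringP cK HK.
apply: (cK X (nbhs x0) (fun x y => b%:E < H (x, y))) => y /HK.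
move=> /lH [V [[A B] /= [nA nB] AB] HV].
exists (B, A) => //= -[y' x'] /= [By' Ax'].
by apply: HV; exact: (AB (x', y')).
Qed.

Lemma compact_seq_cover {X : ptopologicalType} (K : set X) (P : set X -> Prop) :
  compact K -> (forall x, K x -> exists U, [/\ open U, U x & P U]) ->
  exists2 l : seq (set X), (forall U, U \in l -> open U /\ P U) &
    forall x, K x -> exists2 U, U \in l & U x.
Proof.
rewrite compact_cover => cK PK.
have [x Kx|D Dsub Kcov] :=
  cK (set X) [set U | open U /\ P U] id (fun U oPU => oPU.1).
  by have [U [oU Ux PU]] := PK _ Kx; exists U.
exists (finmap.enum_fset D) => [U /Dsub /set_mem //|x /Kcov [U UD Ux]].
by exists U.
Qed.

End Semicontinuity.

(** * Comparing set functions locally *)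

Section Domination.
Context {R : realType} {d : measure_display} {T : measurableType d}.

(** Cutting [B] into pieces subordinate to the cover, the left-hand function can
    only grow and the right-hand one can only shrink. This turns local
    comparisons of integrals into global ones; measurability of the cover is all
    that is asked, so the pieces may be level sets as well as open sets. *)
Lemma le_cover (Psi Phi : set T -> \bar R) :
  Psi set0 <= Phi set0 ->
  (forall A B, measurable A -> measurable B -> [disjoint A & B] ->
    Psi (A `|` B) <= Psi A + Psi B) ->
  (forall A B, measurable A -> measurable B -> [disjoint A & B] ->
    Phi A + Phi B <= Phi (A `|` B)) ->
  forall l : seq (set T),
  (forall V, V \in l -> measurable V /\
    forall B, measurable B -> B `<=` V -> Psi B <= Phi B) ->
  forall B, measurable B -> (forall x, B x -> exists2 V, V \in l & V x) ->
  Psi B <= Phi B.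
Proof.
move=> le0 subPsi supPhi; elim=> [_|V l IH] /=.
  move=> B _ Bl; suff -> : B = set0 by [].
  by apply/seteqP; split => // x /Bl [].
move=> lP B mB BVl.
have [mV VP] := lP V (mem_head _ _).
have mBV : measurable (B `&` V) by exact: measurableI.
have mBDV : measurable (B `\` V) by exact: measurableD.
have dBV : [disjoint B `&` V & B `\` V].
  by rewrite disj_set2E setDE setIACA setICr setI0.
rewrite -(setUIDK B V) (le_trans (subPsi _ _ _ _ _)) //.
rewrite (le_trans _ (supPhi _ _ _ _ _)) // leeD //.
  by apply: VP => //; exact: subIsetr.
apply: IH => // [W Wl|x [Bx nVx]]; first by apply: lP; rewrite inE Wl orbT.
by have [W] := BVl _ Bx; rewrite inE => /orP[/eqP->//|]; exists W.
Qed.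

End Domination.

(** * Inner approximation of integrals by steps on compact sets *)

(** Extended-real sums of suprema: a finite bound [M] forces all the terms to be
    finite, which makes the subtractions legitimate. *)
Lemma ge_ereal_supD {R : realType} (A B : set \bar R) (M : \bar R) :
  A !=set0 -> B !=set0 ->
  (forall a, A a -> 0 <= a) -> (forall b, B b -> 0 <= b) ->
  (forall a b, A a -> B b -> a + b <= M) -> ereal_sup A + ereal_sup B <= M.
Proof.
move=> [a0 Aa0] [b0 Bb0] A0 B0 ABM.
have [->|My] := eqVneq M +oo; first exact: leey.
have finA a : A a -> a \is a fin_num.
  move=> Aa; rewrite ge0_fin_numE ?A0// ltey; apply: contra_neq My => ay.
  have := ABM _ _ Aa Bb0; rewrite ay addye ?leye_eq; first by move/eqP.
  by rewrite gt_eqF// (lt_le_trans _ (B0 _ Bb0)).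
have supB a : A a -> ereal_sup B <= M - a.
  by move=> Aa; apply: ge_ereal_sup => b Bb; rewrite leeBrDl ?finA// ABM.
have B0' : 0 <= ereal_sup B.
  by apply: le_trans (B0 _ Bb0) _; exact: ereal_sup_ubound.
have finB : ereal_sup B \is a fin_num.
  rewrite ge0_fin_numE// (le_lt_trans (supB _ Aa0))//.
  by rewrite lteBlDr ?finA// addye ?ltey// gt_eqF// (lt_le_trans _ (A0 _ Aa0)).
rewrite -leeBrDr//; apply: ge_ereal_sup => a Aa.
by rewrite leeBrDr// -leeBrDl ?finA// supB.
Qed.

Section StepFunctions.
Context {R : realType} {X : ptopologicalType}.
Implicit Types (f s : X -> \bar R) (A B K : set X).
Local Notation measure_on_X := {measure set (borel X) -> \bar R}.

(** The step functions with support in [B] that minorize [f] on finitely many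
    compact sets. The inequality with [f] is strict, because only a strict bound
    on a compact set survives a small perturbation of a semicontinuous [f]. *)
Definition step_below f B s : Prop :=
  [/\ measurable_fun [set: borel X] s, forall x, 0 <= s x,
      forall x, ~ B x -> s x = 0 &
      exists2 l : seq (R * set X),
        (forall p, p \in l ->
          compact p.2 /\ forall x, p.2 x -> p.1%:E < f x) &
        forall x, s x = 0 \/ exists2 p, p \in l & p.2 x /\ s x = p.1%:E].

Lemma step_below0 f B : step_below f B (fun=> 0).
Proof. by split => //; exists [::] => // x; left. Qed.

Lemma step_below_indic f B K (b : R) : hausdorff_space X ->
  compact K -> K `<=` B -> (0 <= b)%R -> (forall x, K x -> b%:E < f x) ->
  step_below f B (fun x => b%:E * (\1_K x)%:E).
Proof.
move=> hX cK KB b0 bf; split.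
- apply: measurable_funeM; apply/measurable_EFinP.
  by apply: measurable_indic; exact: compact_borel.
- by move=> x; rewrite mule_ge0 ?lee_fin.
- by move=> x nBx; rewrite indicE memNset ?mule0// => /KB.
- exists [:: (b, K)] => [p|x]; first by rewrite inE => /eqP ->.
  have [Kx|nKx] := pselect (K x); last by left; rewrite indicE memNset// mule0.
  right; exists (b, K); first exact: mem_head.
  by rewrite indicE mem_set// mule1.
Qed.

Lemma step_belowD f A B s t : [disjoint A & B] ->
  step_below f A s -> step_below f B t -> step_below f (A `|` B) (s \+ t).
Proof.
move=> /disj_setPS AB [ms s0 sA [l lP sl]] [mt t0 tB [m mP tm]].
split => /=.
- exact: emeasurable_funD.
- by move=> x; rewrite adde_ge0.
- by move=> x /not_orP [nA nB]; rewrite sA// tB// adde0.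
exists (l ++ m) => [p|x].
  by rewrite mem_cat => /orP [/lP|/mP].
have [Ax|nAx] := pselect (A x).
  rewrite tB ?adde0; last by move=> Bx; exact: (AB x).
  have [->|[p pl ps]] := sl x; first by left.
  by right; exists p => //; rewrite mem_cat pl.
rewrite sA// add0e.
have [->|[p pl ps]] := tm x; first by left.
by right; exists p => //; rewrite mem_cat pl orbT.
Qed.

(** Keeping track of the support [B] makes the approximation a set function, to
    which [le_cover] applies. *)
Definition step_sup (mu : measure_on_X) f B : \bar R :=
  ereal_sup [set \int[mu]_x s x | s in step_below f B].

Lemma step_sup_ge0 (mu : measure_on_X) f B : 0 <= step_sup mu f B.
Proof.
apply: ereal_sup_ubound; exists (fun=> 0); first exact: step_below0.
by rewrite integral0.
Qed.

Lemma step_sup_superadditive (mu : measure_on_X) f A B : [disjoint A & B] ->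
  step_sup mu f A + step_sup mu f B <= step_sup mu f (A `|` B).
Proof.
move=> AB; apply: ge_ereal_supD.
- by exists (\int[mu]_x 0); exists (fun=> 0) => //; exact: step_below0.
- by exists (\int[mu]_x 0); exists (fun=> 0) => //; exact: step_below0.
- by move=> _ [s [_ s0 _ _] <-]; exact: integral_ge0.
- by move=> _ [s [_ s0 _ _] <-]; exact: integral_ge0.
move=> _ _ [s sA <-] [t tB <-].
have [[ms s0 _ _] [mt t0 _ _]] := (sA, tB).
rewrite -ge0_integralD//; apply: ereal_sup_ubound.
by exists (s \+ t) => //; exact: step_belowD.
Qed.

(** Inner regularity provides the compact sets; lowering the level from [r] to
    any [b < r] provides the strict inequality. *)
Lemma step_sup_ge_level (mu : measure_on_X) f B (r : R) :
  hausdorff_space X -> radon mu -> measurable (B : set (borel X)) ->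
  (0 <= r)%R -> (forall x, B x -> r%:E <= f x) ->
  r%:E * mu B <= step_sup mu f B.
Proof.
move=> hX [_ rmu] mB r0 rf.
have [->|rN0] := eqVneq r 0%R; first by rewrite mul0e step_sup_ge0.
have {r0 rN0}r0 : (0 < r)%R by rewrite lt0r rN0.
suff lt_level b : (0 < b < r)%R -> b%:E * mu B <= step_sup mu f B.
  apply/lee_mul01Pr; first by rewrite mule_ge0// ltW.
  move=> t t01; rewrite muleA -EFinM; apply: lt_level.
  move/andP : t01 => [t0 t1]; rewrite mulr_gt0//=.
  by rewrite -[ltRHS]mul1r ltr_pM2r.
move=> /andP[b0 br]; rewrite -lee_pdivlMl// rmu//.
apply: ge_ereal_sup => _ [K [cK KB] <-]; rewrite lee_pdivlMl//.
have mK := compact_borel hX cK.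
apply: ereal_sup_ubound; exists (fun x => b%:E * (\1_K x)%:E).
  apply: step_below_indic => //; first exact: ltW.
  by move=> x /KB /rf; apply: lt_le_trans; rewrite lte_fin.
rewrite ge0_integralZl//; last 2 first.
- by apply/measurable_EFinP; exact: measurable_indic.
- by rewrite lee_fin ltW.
by rewrite integral_indic// setIT.
Qed.

Import HBNNSimple.

(** The integral is a supremum over simple functions, and a simple function is
    handled level set by level set. *)
Lemma integral_le_step_sup (mu : measure_on_X) f D :
  hausdorff_space X -> radon mu -> measurable (D : set (borel X)) ->
  (forall x, D x -> 0 <= f x) ->
  \int[mu]_(x in D) f x <= step_sup mu f D.
Proof.
move=> hX rmu mD f0; rewrite ge0_integralE//.
apply: ge_ereal_sup => _ [h /= hf <-].
have hfD x : D x -> (h x)%:E <= f x.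
  by move=> Dx; have := hf x; rewrite patchT// mem_set.
have hD : sintegral mu h = \int[mu]_(x in D) (h x)%:E.
  rewrite -integralT_nnsfun [RHS]integral_mkcond; apply: eq_integral => x _.
  rewrite /patch; case: ifPn => // xD; apply/eqP; rewrite eq_le.
  have := hf x; rewrite /patch (negbTE xD) => -> /=.
  by rewrite lee_fin.
rewrite hD.
have mh : measurable_fun [set: borel X] (fun x => (h x)%:E).
  by apply/measurable_EFinP.
have h0 x : 0 <= (h x)%:E by rewrite lee_fin.
have sub (A B : set (borel X)) : [disjoint A & B] -> measurable A ->
    measurable B -> \int[mu]_(x in A `|` B) (h x)%:E =
    \int[mu]_(x in A) (h x)%:E + \int[mu]_(x in B) (h x)%:E.
  by move=> dAB mA mB; rewrite ge0_integral_setU//; exact: measurable_funTS.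
pose l := [seq D `&` (h : borel X -> R) @^-1` [set r] |
  r <- finmap.enum_fset (fset_set (range h))].
apply: (@le_cover R _ (borel X)
  (fun B => \int[mu]_(x in B) (h x)%:E) (step_sup mu f) _ _ _ l) => //.
- by rewrite integral_set0 step_sup_ge0.
- by move=> A B mA mB AB; rewrite sub.
- by move=> A B _ _ AB; exact: step_sup_superadditive.
- move=> _ /mapP [r _ ->]; split; first exact: measurableI.
  move=> B mB Br; rewrite (eq_integral (cst r%:E)); last first.
    by move=> x /set_mem /Br [_ /= ->].
  rewrite integral_cst//.
  (* A point of [B] is what shows that the level [r] is nonnegative. *)
  have [->|/set0P [x0 Bx0]] := eqVneq B set0.
    by rewrite measure0 mule0 step_sup_ge0.
  apply: step_sup_ge_level => //.
    by have [_ /= <-] := Br _ Bx0.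
  by move=> x /Br [Dx /= <-]; exact: hfD.
- move=> x Dx; exists (D `&` (h : borel X -> R) @^-1` [set h x]) => //.
  by apply/mapP; exists (h x) => //; rewrite in_fset_set// mem_set//; exists x.
Qed.

End StepFunctions.

(** * Tonelli theorem for lower semicontinuous kernels *)

Section PartialIntegral.
Context {R : realType} {X Y : ptopologicalType}.
Implicit Types (H : X * Y -> \bar R).

Lemma step_below_section_nbhs H (x0 : X) (B : set Y) s :
  lower_semicontinuous H -> (forall z, 0 <= H z) ->
  step_below (fun y => H (x0, y)) B s ->
  \forall x \near x0, forall y, s y <= H (x, y).
Proof.
move=> lH H0 [_ _ _ [l lP sl]].
have {lP} : \forall x \near x0, forall p, p \in l ->
    forall y, p.2 y -> p.1%:E < H (x, y).
  elim: l lP {sl} => [_|p l IH lP]; first exact: nearW.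
  have [cp pH] := lP p (mem_head _ _).
  have lP' q : q \in l -> compact q.2 /\
      forall y, q.2 y -> q.1%:E < H (x0, y).
    by move=> ql; apply: lP; rewrite inE ql orbT.
  apply: filterS2 (lsc_tube lH cp pH) (IH lP') => x px qx q.
  by rewrite inE => /orP [/eqP ->|/qx].
apply: filterS => x lx y.
have [->//|[p pl [py ->]]] := sl y.
exact/ltW/lx.
Qed.

(** A step function that approximates the integral at [x0] is still a minorant
    at nearby points, so the integral there is almost as large. *)
Lemma lsc_partial_integral H (mu : {measure set (borel Y) -> \bar R})
    (D : set Y) :
  hausdorff_space Y -> radon mu -> lower_semicontinuous H ->
  (forall z, 0 <= H z) -> measurable (D : set (borel Y)) ->
  lower_semicontinuous (fun x => \int[mu]_(y in D) H (x, y)).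
Proof.
move=> hY rmu lH H0 mD x0 a ax0.
have := lt_le_trans ax0
  (integral_le_step_sup hY rmu mD (fun y _ => H0 (x0, y))).
move=> /ereal_sup_gt [_ [s sD <-] as_].
exists [set x | forall y, s y <= H (x, y)].
  exact: step_below_section_nbhs sD.
move=> x sx; apply: lt_le_trans as_ _.
have [ms s0 snD _] := sD.
have -> : \int[mu]_y s y = \int[mu]_(y in D) s y.
  rewrite [RHS]integral_mkcond; apply: eq_integral => y _.
  by rewrite /patch; case: ifPn => // /negP; rewrite inE => /snD.
apply: ge0_le_integral => //; first exact: measurable_funTS.
by apply: measurable_funTS; apply: lsc_borel; exact: lsc_section.
Qed.

End PartialIntegral.

Section Tonelli.
Context {R : realType}.

(** Approximate the inner integral [g] by a step function [s]. Near a point [x]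
    of a compact set [K] where [s = b < g], some step function [t] of the second
    variable satisfies [t <= H (x', _)] for all nearby [x'] and has integral
    larger than [b]. On a small piece [B] of [K] the claim is thus
    [b * nu B <= nu B * \int[mu]_y t y
              <= \int[mu]_y \int[nu]_(x in B) H (x, y)],
    and the pieces are put together by [le_cover]. *)
Lemma tonelli_radon_le {X Y : ptopologicalType} (H : X * Y -> \bar R)
    (nu : {measure set (borel X) -> \bar R})
    (mu : {measure set (borel Y) -> \bar R}) :
  hausdorff_space X -> hausdorff_space Y -> radon nu -> radon mu ->
  lower_semicontinuous H -> (forall z, 0 <= H z) ->
  \int[nu]_x \int[mu]_y H (x, y) <= \int[mu]_y \int[nu]_x H (x, y).
Proof.
move=> hX hY rnu rmu lH H0.
pose Phi (B : set (borel X)) := \int[mu]_y \int[nu]_(x in B) H (x, y).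
have mHX y : measurable_fun [set: borel X] (fun x => H (x, y)).
  by apply: lsc_borel; exact: lsc_section (lsc_swap lH).
have mPhi (B : set (borel X)) : measurable B ->
    measurable_fun [set: borel Y] (fun y => \int[nu]_(x in B) H (x, y)).
  move=> mB; apply: lsc_borel.
  by apply: (lsc_partial_integral hX rnu (lsc_swap lH)) => // -[].
have Phi0 B : 0 <= Phi B.
  by apply: integral_ge0 => y _; exact: integral_ge0.
have PhiD A B : measurable A -> measurable B -> [disjoint A & B] ->
    Phi A + Phi B <= Phi (A `|` B).
  move=> mA mB AB; rewrite -ge0_integralD//.
  - apply: ge0_le_integral => //.
    + by move=> y _; rewrite adde_ge0//; exact: integral_ge0.
    + by apply: emeasurable_funD; exact: mPhi.
    + by apply: mPhi; exact: measurableU.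
    + by move=> y _; rewrite ge0_integral_setU//; exact: measurable_funTS.
  - by move=> y _; exact: integral_ge0.
  - exact: mPhi.
  - by move=> y _; exact: integral_ge0.
  - exact: mPhi.
pose g x := \int[mu]_y H (x, y).
have g0 x : 0 <= g x by exact: integral_ge0.
apply: le_trans (integral_le_step_sup hX rnu measurableT (fun x _ => g0 x)) _.
rewrite /step_sup.
apply: ge_ereal_sup => _ [s [ms s0 _ [l lP sl]] <-].
pose Psi (B : set (borel X)) := \int[nu]_(x in B) s x.
have PsiD A B : measurable A -> measurable B -> [disjoint A & B] ->
    Psi (A `|` B) <= Psi A + Psi B.
  move=> mA mB AB; rewrite /Psi ge0_integral_setU//; exact: measurable_funTS.
have Psi00 : Psi set0 <= Phi set0 by rewrite /Psi integral_set0.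
(* Intersecting with the level set makes [s] constant on [V p] even if the
   compact sets listed in [l] overlap. *)
pose V p : set (borel X) := p.2 `&` [set x | s x = p.1%:E].
have mV p : p \in l -> measurable (V p).
  move=> /lP [cp _]; apply: measurableI; first exact: compact_borel.
  by rewrite -[X in measurable X]setTI; exact: ms (emeasurable_set1 _).
have level_le p : p \in l -> forall B, measurable B -> B `<=` V p ->
    Psi B <= Phi B.
  move=> pl; have [cp pg] := lP _ pl.
  pose P (U : set X) := forall B : set (borel X), measurable B ->
    B `<=` U `&` V p -> Psi B <= Phi B.
  have [x px|lU lUP pU] := @compact_seq_cover X p.2 P cp.
    have := lt_le_trans (pg _ px)
      (integral_le_step_sup hY rmu measurableT (fun y _ => H0 (x, y))).
    move=> /ereal_sup_gt [_ [t tT <-] pt].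
    have : nbhs x [set x' | forall y, t y <= H (x', y)].
      exact: step_below_section_nbhs tT.
    rewrite nbhsE /= => -[U [oU Ux] UH].
    exists U; split => // B mB BUV.
    have [mt t0 _ _] := tT.
    have -> : Psi B = p.1%:E * nu B.
      rewrite -integral_cst//; apply: eq_integral => x' /set_mem /BUV.
      by case=> _ [].
    apply: (@le_trans _ _ (\int[mu]_y (nu B * t y))).
      rewrite ge0_integralZl// muleC.
      by apply: lee_wpmul2l => //; exact: ltW.
    apply: ge0_le_integral => //.
    - by move=> y _; exact: mule_ge0.
    - exact: measurable_funeM.
    - exact: mPhi.
    move=> y _; rewrite muleC -integral_cst//.
    apply: ge0_le_integral => //.
    - by move=> x' _ /=.
    - exact: measurable_funTS.
    - by move=> x' /BUV [/UH Hx' _] /=.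
  move=> B mB BV.
  apply: (@le_cover R _ (borel X) Psi Phi Psi00 PsiD PhiD
    [seq U `&` V p | U <- lU]) => //.
    move=> _ /mapP [U /lUP [oU PU] ->]; split; last exact: PU.
    by apply: measurableI; [exact: open_borel|exact: mV].
  move=> x Bx; have [U UlU Ux] := pU _ (BV _ Bx).1.
  by exists (U `&` V p); [apply/mapP; exists U|split => //; exact: BV].
apply: (@le_cover R _ (borel X) Psi Phi Psi00 PsiD PhiD
  ([set x | s x = 0] :: [seq V p | p <- l])) => //.
- move=> W; rewrite inE => /predU1P [->|/mapP [p pl ->]].
    split.
      by rewrite -[X in measurable X]setTI; exact: ms (emeasurable_set1 _).
    move=> B mB B0; rewrite (_ : Psi B = 0) ?Phi0//.
    by apply: integral0_eq => x /B0.
  by split; [exact: mV|exact: level_le].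
- move=> x _; have [sx0|[p pl [px sx]]] := sl x.
    by exists [set x | s x = 0] => //; exact: mem_head.
  exists (V p) => //; rewrite inE; apply/orP; right.
  by apply/mapP; exists p.
Qed.

Lemma tonelli_radon {X Y : ptopologicalType} (H : X * Y -> \bar R)
    (nu : {measure set (borel X) -> \bar R})
    (mu : {measure set (borel Y) -> \bar R}) :
  hausdorff_space X -> hausdorff_space Y -> radon nu -> radon mu ->
  lower_semicontinuous H -> (forall z, 0 <= H z) ->
  \int[nu]_x \int[mu]_y H (x, y) = \int[mu]_y \int[nu]_x H (x, y).
Proof.
move=> hX hY rnu rmu lH H0; apply/eqP; rewrite eq_le tonelli_radon_le//=.
by apply: (tonelli_radon_le hY hX rmu rnu (lsc_swap lH)).
Qed.

End Tonelli.

(** * Test functions *)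

Section TestFunctions.
Context {R : realType} {X : ptopologicalType}.
Implicit Types (phi psi : X -> R).

Lemma continuous_lsc phi :
  continuous phi -> lower_semicontinuous (fun x => (phi x)%:E).
Proof.
move=> cphi; apply/lower_semicontinuousP => a.
rewrite [X in open X](_ : _ = phi @^-1` [set r | (a < r)%R]); last first.
  by apply/seteqP; split=> x /=; rewrite lte_fin.
by apply: open_comp; [move=> x _; exact: cphi|exact: open_gt].
Qed.

Lemma compact_support_sub phi (K : set X) : compact K -> closed K ->
  [set x | phi x != 0%R] `<=` K -> compact (closure [set x | phi x != 0%R]).
Proof.
move=> cK clK sK; apply: subclosed_compact cK _; first exact: closed_closure.
by move/closure_id : clK => ->; exact: closureS.
Qed.

Lemma Ccplus_scale phi (c : R) : (0 <= c)%R ->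
  Ccplus phi -> Ccplus (fun x => c * phi x)%R.
Proof.
move=> c0 [cphi phi0 sphi]; split.
- by move=> x; apply: cvgM; [exact: cvg_cst|exact: cphi].
- by move=> x; rewrite mulr_ge0.
- apply: compact_support_sub sphi (@closed_closure _ _) _ => x /= cphix.
  apply: subset_closure => /=; apply: contra_neq cphix => ->.
  by rewrite mulr0.
Qed.

Lemma Ccplus_max phi psi :
  Ccplus phi -> Ccplus psi -> Ccplus (fun x => Num.max (phi x) (psi x)).
Proof.
move=> [cphi phi0 sphi] [cpsi psi0 spsi]; split.
- by move=> x; apply: continuous_max; [exact: cphi|exact: cpsi].
- by move=> x; rewrite le_max phi0.
- have cU := compactU sphi spsi.
  apply: compact_support_sub cU _ _.
    by apply: closedU; exact: closed_closure.
  move=> x phipsi; rewrite -closureU; apply: subset_closure => /=.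
  have [p0|p0] := eqVneq (phi x) 0%R; [right|by left].
  by move: phipsi; rewrite /= p0 max_r.
Qed.

(** Complete regularity separates a point of [K] from the complement of a
    relatively compact neighbourhood inside [U]; truncating the separating
    function makes it equal to 1 on a whole neighbourhood of the point, and the
    maximum over a finite cover of [K] is the required function. *)
Lemma urysohn_compact (K U : set X) :
  hausdorff_space X -> locally_compact [set: X] ->
  compact K -> open U -> K `<=` U ->
  exists phi, [/\ Ccplus phi, forall x, (phi x <= 1)%R,
    forall x, ~ U x -> phi x = 0%R & forall x, K x -> phi x = 1%R].
Proof.
move=> hX lX cK oU KU.
pose good (V : set X) phi := [/\ Ccplus phi, forall x, (phi x <= 1)%R,
    forall x, ~ U x -> phi x = 0%R & forall x, V x -> phi x = 1%R].
have [x Kx|l lP Kl] :=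
  @compact_seq_cover X K (fun V => exists phi, good V phi) cK.
  have := lX x I; rewrite withinET => -[W nW [cW clW]].
  pose O := U `&` W°.
  have oO : open O by apply: openI => //; exact: open_interior.
  have Ox : O x by split; [exact: KU|].
  have := @locally_compact_completely_regular X R lX hX x (~` O).
  move=> /(_ (open_closedC oO) (fun nOx => nOx Ox)).
  move=> /(@uniform_separatorP _ R) [f [cf f01 f0 f1]].
  have fx : f x = 0%R by apply: f0; exists x.
  have fO y : ~ O y -> f y = 1%R by move=> nOy; apply: f1; exists y.
  have f_itv y : (0 <= f y <= 1)%R.
    have /= := f01 (f y) (ex_intro2 _ _ y I erefl).
    by rewrite in_itv.
  pose phi y := Num.min 1%R (2 * (1 - f y))%R.
  have phi_nO y : ~ O y -> phi y = 0%R.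
    by move=> /fO; rewrite /phi => ->; rewrite subrr mulr0 min_r.
  exists [set y | (f y < 2^-1)%R]; split => //=.
  - rewrite [X in open X](_ : _ = f @^-1` [set r | (r < 2^-1)%R])//.
    by apply: open_comp; [move=> y _; exact: cf|exact: open_lt].
  - by rewrite fx invr_gt0.
  exists phi; split.
  - split.
    + move=> y; apply: (@continuous_min R X (fun=> 1%R)
        (fun y => 2 * (1 - f y))%R); first exact: cvg_cst.
      apply: cvgM; first exact: cvg_cst.
      by apply: cvgB; [exact: cvg_cst|exact: cf].
    + move=> y; rewrite le_min ler01/= mulr_ge0// subr_ge0.
      by have /andP[] := f_itv y.
    + apply: compact_support_sub cW clW _ => y /= phiy.
      apply: contrapT => nWy; move/eqP : phiy; apply; apply: phi_nO.
      by move=> [_ /interior_subset].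
  - by move=> y; rewrite ge_min lexx.
  - by move=> y nUy; apply: phi_nO => -[].
  - move=> y /= fy; rewrite /phi min_l//.
    by move: fy; lra.
have {lP} : forall V, V \in l -> exists phi, good V phi.
  by move=> V /lP [].
suff : (forall V, V \in l -> exists phi, good V phi) ->
    exists phi, good [set x | exists2 V, V \in l & V x] phi.
  move=> + H => /(_ H) [phi [cphi phi1 phiU phil]].
  by exists phi; split => // x /Kl; exact: phil.
elim: l {Kl} => [_|V l IH lP].
  exists (fun=> 0%R); split => //; last by move=> x [].
  split => //; first by move=> x; exact: cvg_cst.
  by apply: compact_support_sub (@compact0 _) closed0 _ => x /=; rewrite eqxx.
have [phi [cphi phi1 phiU phiV]] := lP V (mem_head _ _).
have [|psi [cpsi psi1 psiU psil]] := IH.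
  by move=> W Wl; apply: lP; rewrite inE Wl orbT.
exists (fun x => Num.max (phi x) (psi x)); split.
- exact: Ccplus_max.
- by move=> x; rewrite ge_max phi1 psi1.
- by move=> x nUx; rewrite phiU// psiU// maxxx.
- move=> x [W]; rewrite inE => /predU1P[->|Wl] Wx; apply/eqP.
    by rewrite phiV// eq_le ge_max lexx psi1 le_max lexx.
  rewrite (psil x); last by exists W.
  by rewrite eq_le ge_max lexx phi1 le_max lexx orbT.
Qed.

End TestFunctions.

(** * Sets of capacity zero *)

Section ZeroCapacity.
Context {R : realType} {X : ptopologicalType}.
Local Notation measure_on_X := {measure set (borel X) -> \bar R}.
Implicit Types (G : X * X -> \bar R) (mu nu : measure_on_X).

Lemma radon_mscale (k : {nonneg R}) nu : radon nu -> radon (mscale k nu).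
Proof.
move=> [nuK nuA]; split=> [K cK|A mA].
  by rewrite /mscale/= lte_mul_pinfty ?lee_fin// nuK.
transitivity (k%:num%:E * nu A) => //; rewrite nuA// -ereal_supZl//; last first.
  by apply/set0P; exists (nu set0), set0 => //; split => //; exact: compact0.
by rewrite image_comp.
Qed.

Lemma potential_lsc G nu : hausdorff_space X -> is_kernel G -> radon nu ->
  lower_semicontinuous (potential G nu).
Proof.
move=> hX [G0 lG _ _] rnu.
exact: (@lsc_partial_integral R X X G nu setT hX rnu lG G0 measurableT).
Qed.

Lemma potential_ge0 G nu x : is_kernel G -> 0 <= potential G nu x.
Proof. by move=> [G0 _ _ _]; exact: integral_ge0. Qed.

Lemma energy_ge0 G nu : is_kernel G -> 0 <= \int[nu]_x potential G nu x.
Proof. by move=> kG; apply: integral_ge0 => x _; exact: potential_ge0. Qed.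

Lemma energy_mscale G nu (k : {nonneg R}) : hausdorff_space X -> is_kernel G ->
  radon nu ->
  \int[mscale k nu]_x potential G (mscale k nu) x =
  (k%:num ^+ 2)%:E * \int[nu]_x potential G nu x.
Proof.
move=> hX kG rnu; have [G0 lG _ _] := kG.
have mpot := lsc_borel (potential_lsc hX kG rnu).
have -> : potential G (mscale k nu) = fun x => k%:num%:E * potential G nu x.
  apply/funext => x; rewrite /potential ge0_integral_mscale//.
  by apply: lsc_borel; exact: lsc_section.
rewrite ge0_integral_mscale//; last 2 first.
- exact: measurable_funeM.
- by move=> x _; rewrite mule_ge0 ?lee_fin// potential_ge0.
rewrite ge0_integralZl//; last by move=> x _; exact: potential_ge0.
by rewrite muleA -EFinM.
Qed.

(** With [e] the energy of [nu], the factor [k = 1 / (1 + e)] satisfies [k <= 1]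
    and [k * e <= 1], hence [k ^+ 2 * e <= 1]; dividing by the norm would
    require a separate treatment of the measures of energy zero. *)
Lemma Eplus_normalize G nu : hausdorff_space X -> is_kernel G -> Eplus G nu ->
  exists2 k : {nonneg R}, (0 < k%:num)%R & Eplus1 G (mscale k nu).
Proof.
move=> hX kG [rnu]; rewrite /energy_norm => Enu.
have E0 := energy_ge0 nu kG.
have Efin : \int[nu]_x potential G nu x \is a fin_num.
  by rewrite -sqrte_fin_num// ge0_fin_numE ?sqrte_ge0.
pose e := fine (\int[nu]_x potential G nu x).
have e0 : (0 <= e)%R by exact: fine_ge0.
have k0 : (0 <= (1 + e)^-1)%R by rewrite invr_ge0 addr_ge0.
exists (NngNum k0) => /=; first by rewrite invr_gt0 ltr_wpDr.
split; first exact: radon_mscale.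
have -> : 1 = sqrte 1 :> \bar R by rewrite /= sqrtr1.
rewrite /energy_norm energy_mscale// lee_sqrt//=.
rewrite -(fineK Efin) -/e -EFinM lee_fin.
have e1 : (0 < 1 + e)%R by rewrite ltr_wpDr.
rewrite exprVn mulrC ler_pdivrMr ?exprn_gt0// mul1r expr2.
by nra.
Qed.

(** A Urysohn function between [K] and the open set where [g > c] is, after
    multiplication by [c], a test function below [g]. *)
Lemma cap_lsc_ge_compact G nu (g : X -> \bar R) (K : set X) (c : R) :
  hausdorff_space X -> locally_compact [set: X] ->
  Eplus1 G nu -> lscplus g -> compact K -> (0 <= c)%R ->
  (forall x, K x -> c%:E < g x) -> c%:E * nu K <= cap_lsc G g.
Proof.
move=> hX lX nuE [g0 lg] cK c0 Kg.
have oU : open [set x | c%:E < g x] by move/lower_semicontinuousP : (lg); exact.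
have [phi [cphi phi1 phiU phiK]] := @urysohn_compact R X _ _ hX lX cK oU Kg.
have cphi' := Ccplus_scale c0 cphi.
apply: (@le_trans _ _ (cap_cont G (fun x => c * phi x)%R)); last first.
  apply: ereal_sup_ubound; exists (fun x => c * phi x)%R => //.
  split=> // x; have [Ux|nUx] := pselect (c%:E < g x).
    apply: le_trans (ltW Ux); rewrite lee_fin -[leRHS]mulr1.
    by rewrite ler_wpM2l.
  by rewrite phiU// mulr0.
apply: (@le_trans _ _ (\int[nu]_x (c * phi x)%:E)); last first.
  by apply: ereal_sup_ubound; exists nu.
have mK := compact_borel hX cK.
rewrite -[leLHS](_ : \int[nu]_x (c%:E * (\1_K x)%:E) = _); last first.
  rewrite ge0_integralZl//; last exact/measurable_EFinP/measurable_indic.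
  by rewrite integral_indic// setIT.
apply: ge0_le_integral => //.
- by move=> x _; rewrite mule_ge0 ?lee_fin.
- by apply: measurable_funeM; exact/measurable_EFinP/measurable_indic.
- by apply: lsc_borel; apply: continuous_lsc; case: cphi'.
move=> x _; rewrite -EFinM lee_fin ler_wpM2l// indicE.
have [Kx|nKx] := pselect (K x); first by rewrite mem_set// phiK.
by rewrite memNset//; case: cphi.
Qed.

(** The majorants of the indicator of [E] exceed [1/2] on [E], so the measure of
    a compact subset, up to a fixed factor, is a lower bound of their
    capacities. *)
Lemma zero_capacity_null G nu (E : set X) (B : set (borel X)) :
  hausdorff_space X -> locally_compact [set: X] -> is_kernel G ->
  Eplus G nu -> outer_cap_set G E = 0 -> measurable B -> B `<=` E -> nu B = 0.
Proof.
move=> hX lX kG nuE cE mB BE; apply/eqP; rewrite eq_le measure_ge0 andbT.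
have [k k0 kE] := Eplus_normalize hX kG nuE.
rewrite nuE.1.2//; apply: ge_ereal_sup => _ [K [cK KB] <-].
suff : (2^-1)%:E * mscale k nu K <= 0.
  by rewrite /mscale/= !pmule_rle0 ?lte_fin// invr_gt0.
rewrite -cE; apply: le_ereal_inf_tmp => _ [g [gl Eg] <-].
apply: cap_lsc_ge_compact => // x /KB /BE Ex.
by apply: lt_le_trans (Eg x); rewrite indicE mem_set// lte_fin invf_lt1 ?ltr1n.
Qed.

End ZeroCapacity.

(** * Dual capacities *)

Section DualCapacity.
Context {R : realType} {X : ptopologicalType}.
Local Notation measure_on_X := {measure set (borel X) -> \bar R}.
Implicit Types (G : X * X -> \bar R) (mu nu : measure_on_X).

(** The set where the inequality fails is contained in a set of capacity zero,
    hence is null for every measure of finite energy. *)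
Lemma Gamma_upper_sub_lower G (f : X -> \bar R) :
  hausdorff_space X -> locally_compact [set: X] -> is_kernel G ->
  Gamma_upper G f `<=` Gamma_lower G f.
Proof.
move=> hX lX kG la [laE [E [cE fE]]]; split => // nu nuE.
have mpot := lsc_borel (potential_lsc hX kG laE.1).
apply: ge_ereal_sup => _ [h [mh h0 hf] <-].
pose N : set (borel X) := [set x | potential G la x < h x].
have mN : measurable N.
  by rewrite -[N]setTI; exact: measurable_lte.
have NE : N `<=` E.
  move=> x /= Nx; apply: contrapT => /fE fx.
  by have := lt_le_trans Nx (le_trans (hf x) fx); rewrite ltxx.
apply: ae_ge0_le_integral => //.
- by move=> x _; exact: potential_ge0.
exists N; split => //; first exact: (zero_capacity_null hX lX kG nuE cE mN NE).
by move=> x /= /not_implyP [_ /negP]; rewrite -ltNge.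
Qed.

(** The content is that the empty set has capacity zero; [Eplus1] is known to be
    inhabited because [mu] can be normalized. *)
Lemma mem_Gamma_upper_potential G mu : hausdorff_space X -> is_kernel G ->
  Eplus G mu -> Gamma_upper G (potential G mu) mu.
Proof.
move=> hX kG muE; split => //; exists set0; split => //.
have [k _ kE] := Eplus_normalize hX kG muE.
have C0 : Ccplus (fun=> 0%R : R).
  split => //; first by move=> x; exact: cvg_cst.
  by apply: compact_support_sub (@compact0 _) closed0 _ => x /=; rewrite eqxx.
apply/eqP; rewrite eq_le; apply/andP; split.
  apply: (@le_trans _ _ (cap_lsc G (fun=> 0))).
    apply: ereal_inf_lbound; exists (fun=> 0) => //; split => [|x].
      split => //; apply: (@continuous_lsc R X (fun=> 0%R)).
      by move=> y; exact: cvg_cst.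
    by rewrite indic0.
  apply: ge_ereal_sup => _ [phi [[_ phi0 _] phile] <-].
  apply: ge_ereal_sup => _ [nu _ <-]; rewrite integral0_eq// => x _.
  by apply/eqP; rewrite eq_le phile lee_fin phi0.
apply: le_ereal_inf_tmp => _ [g [[g0 _] _] <-].
apply: (@le_trans _ _ (cap_cont G (fun=> 0%R))).
  by apply: ereal_sup_ubound; exists (mscale k mu) => //; rewrite integral0.
by apply: ereal_sup_ubound; exists (fun=> 0%R).
Qed.

Lemma mutual_energy_sym G mu nu : hausdorff_space X -> is_kernel G ->
  radon mu -> radon nu ->
  \int[nu]_x potential G mu x = \int[mu]_x potential G nu x.
Proof.
move=> hX [G0 lG symG _] rmu rnu.
rewrite /potential (@tonelli_radon R X X G nu mu hX hX rnu rmu lG G0).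
by apply: eq_integral => y _; apply: eq_integral => x _; rewrite symG.
Qed.

(** Test [la] against [mu], exchange the two measures, then test [la] against
    itself. *)
Lemma energy_norm_min G mu la : hausdorff_space X -> is_kernel G ->
  Eplus G mu -> Gamma_lower G (potential G mu) la ->
  energy_norm G mu <= energy_norm G la.
Proof.
move=> hX kG muE [laE laG].
rewrite /energy_norm lee_sqrt ?energy_ge0//.
have mpot := lsc_borel (potential_lsc hX kG muE.1).
have lower nu : Eplus G nu ->
    \int[nu]_x potential G mu x <= \int[nu]_x potential G la x.
  move=> nuE; apply: le_trans (laG _ nuE); apply: ereal_sup_ubound.
  by exists (potential G mu) => //; split => // x; exact: potential_ge0.
apply: le_trans (lower _ muE) _.
by rewrite (mutual_energy_sym hX kG laE.1 muE.1) lower.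
Qed.

End DualCapacity.

Theorem lemma3p3 (R : realType) (X : ptopologicalType)
    (X_hausdorff : hausdorff_space X)
    (X_locally_compact : locally_compact [set: X])
    (G : X * X -> \bar R) (G_kernel : is_kernel G)
    (mu : {measure set (borel X) -> \bar R}) (mu_Eplus : Eplus G mu) :
  dual_cap_upper G (potential G mu) = dual_cap_lower G (potential G mu) /\
  dual_cap_lower G (potential G mu) = energy_norm G mu.
Proof.
have low_up : dual_cap_lower G (potential G mu) <=
    dual_cap_upper G (potential G mu).
  apply: ereal_inf_le_tmp => _ [la laG <-]; exists la => //.
  exact: Gamma_upper_sub_lower laG.
have up_mu : dual_cap_upper G (potential G mu) <= energy_norm G mu.
  by apply: ereal_inf_lbound; exists mu => //; exact: mem_Gamma_upper_potential.
have mu_low : energy_norm G mu <= dual_cap_lower G (potential G mu).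
  by apply: le_ereal_inf_tmp => _ [la laG <-]; exact: energy_norm_min laG.
split; apply/eqP; rewrite eq_le ?low_up ?mu_low ?andbT /=.
  exact: le_trans up_mu mu_low.
exact: le_trans low_up up_mu.
Qed.
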